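(* Let $k \in \mathbb{N}^+$, $\pi \in [0,1]$ and $\varepsilon > 0$, and put $\delta := 1 - \pi$ and $\sigma := 3^{k-1}\varepsilon$. Let $X$ be a finite set with at least two elements such that \[ \varepsilon \ge 2k \log_{|X|} 2 \qquad\text{and}\qquad \pi \ge (k-1)\log_{|X|} 2 . \] Then every $(\delta,\varepsilon)$-homogeneous $k$-uniform hypergraph $H \subseteq [X]^k$ admits a $(\pi,\sigma)$-print/container pair. Explicitly: there exist relations $\mathcal{P} \subseteq \mathcal{I}_X(H) \times \mathrm{Prints}_{\pi,k}(X)$ and $\mathcal{C} \subseteq \mathrm{Prints}_{\pi,k}(X) \times \mathcal{P}(X)$ such that (i) every $H$-independent set $I \subseteq X$ is $\mathcal{P}$-related to at least one $(\pi,k)$-print; (ii) every print in the image of $\mathcal{P}$ is $\mathcal{C}$-related to at least one set $C \subseteq X$; (iii) whenever $I \in \mathcal{I}_X(H)$, $\mathbf{F} \in \mathrm{Prints}_{\pi,k}(X)$, $C \subseteq X$ satisfy $I \,\mathcal{P}\, \mathbf{F}$ and $\mathbf{F} \,\mathcal{C}\, C$, we have $\bigcup \mathbf{F} \subseteq I \subseteq \bigcup\mathbf{F} \cup C$; (iv) every set $C$ in the image of $\mathcal{C}$ satisfies $\log_{|X|}|X \setminus C| \ge 1 - \sigma$.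
   Context: Throughout, $\log_{|X|}$ is the logarithm to base $|X|$, with the convention $\log_{|X|} 0 = -\infty$. For a set $X$ and $k \in \mathbb{N}^+$, $[X]^k$ denotes the set of $k$-element subsets of $X$; a $k$-uniform hypergraph on $X$ is a subset $H \subseteq [X]^k$. A set $I \subseteq X$ is $H$-independent if no element of $H$ is a subset of $I$; $\mathcal{I}_X(H)$ is the set of all $H$-independent subsets of $X$. For $1 \le \ell < k$ and $u \in [X]^\ell$, let $H_u := \{v \in [X]^{k-\ell} : u \cup v \in H\}$, $\deg_H(u) := |H_u|$, and $\Delta_\ell(H) := \max_{u \in [X]^\ell} \deg_H(u)$. For $\delta \in [0,1]$, $H$ is $\delta$-bounded if $\Delta_\ell(H) \le |X|^{(k-\ell)\delta}$ for every $\ell \in \{1,\dots,k-1\}$ (vacuous when $k=1$). For $\varepsilon>0$, $H$ is $(\delta,\varepsilon)$-homogeneous if it is $\delta$-bounded and $\log_{|X|}|H| \ge 1 + (k-1)\delta - \varepsilon$. A $\pi$-fingerprint is a subset $F \subseteq X$ with $\log_{|X|}|F| \le \pi$ (the empty set is allowed). A $(\pi,k)$-print is a finite sequence $\mathbf{F} = (F_i)_{0 \le i < \ell}$ of $\pi$-fingerprints with $0 \le \ell \le k-1$ (the empty sequence is allowed); $\bigcup\mathbf{F} := \bigcup_{i<\ell} F_i$, and $\mathrm{Prints}_{\pi,k}(X)$ denotes the set of all $(\pi,k)$-prints in $X$. $\mathcal{P}(X)$ is the power set of $X$. For a relation $R \subseteq A \times B$, its image is $\{b : \exists a,\ a R b\}$.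 *)

(* Defs.v *)
From HB Require Import structures.
From mathcomp Require Import all_boot all_order all_algebra.
From mathcomp Require Import boolp classical_sets reals ereal.
From mathcomp Require Import exp.

Set Implicit Arguments.
Unset Strict Implicit.
Unset Printing Implicit Defensive.

Import Order.TTheory GRing.Theory Num.Theory.

Local Open Scope ring_scope.
Local Open Scope ereal_scope.
Local Open Scope classical_set_scope.

(* log_{|X|} n, with log_{|X|} 0 = -oo; meaningful when 1 < #|X|. *)
Definition logX (R : realType) (X : finType) (n : nat) : \bar R :=
  if n == 0%N then -oo else (ln n%:R / ln #|X|%:R)%R%:E.

Definition ksubsets (X : finType) (k : nat) : {set {set X}} :=
  [set A : {set X} | #|A| == k]%SET.

Definition uniform (X : finType) (k : nat) (H : {set {set X}}) : Prop :=
  H \subset ksubsets X k.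

Definition independent (X : finType) (H : {set {set X}}) (I : {set X}) : Prop :=
  forall e : {set X}, e \in H -> ~ (e \subset I).

Definition link (X : finType) (k : nat) (H : {set {set X}}) (u : {set X}) :
    {set {set X}} :=
  [set v in ksubsets X (k - #|u|) | (u :|: v)%SET \in H]%SET.

Definition deg (X : finType) (k : nat) (H : {set {set X}}) (u : {set X}) : nat :=
  #|link k H u|.

Definition maxdeg (X : finType) (k : nat) (H : {set {set X}}) (l : nat) : nat :=
  (\max_(u in ksubsets X l) deg k H u)%N.

Definition bounded (R : realType) (X : finType) (k : nat) (delta : R)
    (H : {set {set X}}) : Prop :=
  forall l : nat, (1 <= l < k)%N ->
    ((maxdeg k H l)%:R <= #|X|%:R `^ ((k - l)%N%:R * delta) :> R)%R.

Definition homogeneous (R : realType) (X : finType) (k : nat) (delta eps : R)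
    (H : {set {set X}}) : Prop :=
  bounded k delta H /\ (1 + k.-1%:R * delta - eps)%R%:E <= logX R X #|H|.

Definition fingerprint (R : realType) (X : finType) (pi : R) (F : {set X}) : Prop :=
  logX R X #|F| <= pi%:E.

Definition print_union (X : finType) (F : seq {set X}) : {set X} :=
  (\bigcup_(A <- F) A)%SET.

Definition prints (R : realType) (X : finType) (pi : R) (k : nat) :
    set (seq {set X}) :=
  [set F | (size F <= k.-1)%N /\ forall A, A \in F -> fingerprint pi A].

Definition indep_sets (X : finType) (H : {set {set X}}) : set {set X} :=
  [set I | independent H I].

Definition print_container_pair (R : realType) (X : finType) (k : nat)
    (pi sigma : R) (H : {set {set X}})
    (P : set ({set X} * seq {set X})) (C : set (seq {set X} * {set X})) : Prop :=
  [/\ P `<=` indep_sets H `*` prints pi k,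
      C `<=` prints pi k `*` [set: {set X}] &
  [/\ (forall I, indep_sets H I -> exists F, P (I, F)),
      (forall F, (exists I, P (I, F)) -> exists D, C (F, D)),
      (forall I F D, P (I, F) -> C (F, D) ->
         (print_union F \subset I) && (I \subset print_union F :|: D)%SET) &
      (forall D, (exists F, C (F, D)) ->
         (1 - sigma)%R%:E <= logX R X #|(~: D)%SET|)]].

(* Main.v *)
(** Induction on the uniformity. For [F] contained in an independent set [I] of
    a [(k+1)]-uniform [H], every family [G] inside the union of the links of the
    vertices of [F] is [k]-uniform and still has [I] as an independent set. Let
    [g F] be the largest size of a delta-bounded such family, and let [F] be
    maximal among the subsets of [I] of size at most [|X|^pi] on which [g]
    averages at least [t] per vertex, where [t] is about [|H| / |X|]. If [g F]
    is large, an optimal family is [(delta, 3 eps)]-homogeneous and one recurses.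
    Otherwise [F] has not reached full size, so [I] is contained in [F] together
    with the vertices whose addition to [F] raises [g] by less than [t].
    The other vertices are numerous: few edges of [H] contain a set whose degree
    in the optimal family exceeds half its cap, by averaging many vertices lie
    on many of the remaining edges, and a constant proportion of the link of such
    a vertex can be added to the family. As [g F] depends only on the set [F], so
    does the container. *)

Require Import Defs.
From HB Require Import structures.
From mathcomp Require Import all_boot all_order all_algebra.
From mathcomp Require Import boolp classical_sets reals ereal.
From mathcomp Require Import exp.
From mathcomp Require Import zify ring lra.
From mathcomp Require Import fintype finset.

Set Implicit Arguments.
Unset Strict Implicit.
Unset Printing Implicit Defensive.

Import Order.TTheory GRing.Theory Num.Theory.

(** * Degrees, caps and vertex links *)

Section Hypergraphs.
Local Open Scope nat_scope.
Local Open Scope set_scope.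
Variable X : finType.
Implicit Types (H G A B : {set {set X}}) (u e f F I : {set X}) (v : X).

(** Counting whole edges needs no uniformity [k] and makes sense for [u] of every size, edges
    included. *)
Definition covdeg H u : nat := #|[set e in H | u \subset e]|.

(* For |u| >= k the truncated subtraction makes the cap [d 0], which will be 1,
   so the condition is then automatic for k-uniform hypergraphs. *)
Definition capped (d : nat -> nat) (k : nat) H : bool :=
  [forall u : {set X}, (u != set0) ==> (covdeg H u <= d (k - #|u|))].

Definition vlink H v : {set {set X}} :=
  [set f : {set X} | (v \notin f) && (v |: f \in H)].

Lemma uniform_card k H e : uniform k H -> e \in H -> #|e| = k.
Proof. by move=> /subsetP h /h; rewrite inE => /eqP. Qed.

Lemma uniform_sub k A B : A \subset B -> uniform k B -> uniform k A.
Proof. by move=> sAB; apply: subset_trans. Qed.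

Lemma covdegS A B u : A \subset B -> covdeg A u <= covdeg B u.
Proof.
move=> /subsetP sAB; apply: subset_leq_card; apply/subsetP => e.
by rewrite !inE => /andP[/sAB -> ->].
Qed.

Lemma covdegU A B u : covdeg (A :|: B) u <= covdeg A u + covdeg B u.
Proof.
rewrite /covdeg; set C := [set e in _ :|: _ | _].
suff -> : C = [set e in A | u \subset e] :|: [set e in B | u \subset e].
  by rewrite cardsU leq_subr.
by apply/setP => e; rewrite !inE andb_orl.
Qed.

Lemma covdeg_set1_notsub f u : ~~ (u \subset f) -> covdeg [set f] u = 0.
Proof.
move=> nuf; apply/eqP; rewrite cards_eq0 -subset0; apply/subsetP => e.
by rewrite !inE => /andP[/eqP ->]; rewrite (negbTE nuf).
Qed.

Lemma covdeg_set1_le1 f u : covdeg [set f] u <= 1.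
Proof.
rewrite -(cards1 f); apply: subset_leq_card; apply/subsetP => e.
by rewrite !inE => /andP[].
Qed.

Lemma covdeg_gt0 H u e : e \in H -> u \subset e -> 0 < covdeg H u.
Proof. by move=> eH ue; apply/card_gt0P; exists e; rewrite inE eH. Qed.

Lemma covdeg_gt0_card k H u : uniform k H -> 0 < covdeg H u -> #|u| <= k.
Proof.
move=> unif /card_gt0P[e]; rewrite inE => /andP[eH /subset_leq_card].
by rewrite (uniform_card unif eH).
Qed.

Lemma covdeg_sum H u : covdeg H u = \sum_(e in H) (u \subset e).
Proof.
rewrite /covdeg -sum1dep_card big_mkcondr /=.
by apply: eq_bigr => e _; case: ifP.
Qed.

(** Double counting: an edge has [2 ^ k] subsets. *)
Lemma sum_covdeg k H (P : pred {set X}) :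
  uniform k H -> \sum_(u | P u) covdeg H u <= 2 ^ k * #|H|.
Proof.
move=> unif; rewrite mulnC.
have -> : \sum_(u | P u) covdeg H u = \sum_(e in H) \sum_(u | P u) (u \subset e).
  by under eq_bigr do rewrite covdeg_sum; rewrite exchange_big.
rewrite -sum_nat_const; apply: leq_sum => e eH.
rewrite -(uniform_card unif eH) -card_powerset -sum1_card big_mkcond.
rewrite [leqRHS]big_mkcond; apply: leq_sum => u _.
by rewrite inE; case: (P u).
Qed.

Lemma card_le_sum_covdeg A (P : pred {set X}) :
  (forall f, f \in A -> exists2 u, P u & u \subset f) ->
  #|A| <= \sum_(u | P u) covdeg A u.
Proof.
move=> cov.
have -> : \sum_(u | P u) covdeg A u = \sum_(e in A) \sum_(u | P u) (u \subset e).
  by under eq_bigr do rewrite covdeg_sum; rewrite exchange_big.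
rewrite -sum1_card; apply: leq_sum => f /cov[u Pu uf].
by rewrite (bigD1 u) //= uf.
Qed.

Lemma cappedP d k H :
  reflect (forall u, u != set0 -> covdeg H u <= d (k - #|u|)) (capped d k H).
Proof.
by apply: (iffP forallP) => [h u u0|h u]; [apply: (implyP (h u))|apply/implyP/h].
Qed.

Lemma vlinkS A B v : A \subset B -> vlink A v \subset vlink B v.
Proof.
by move=> /subsetP sAB; apply/subsetP => f; rewrite !inE => /andP[-> /sAB].
Qed.

Lemma setU1_vlink_inj H v : {in vlink H v &, injective (fun f => v |: f)}.
Proof.
move=> f g; rewrite !inE => /andP[vf _] /andP[vg _] /(congr1 (fun s => s :\ v)).
by rewrite !setU1K.
Qed.

Lemma card_vlink H v : #|vlink H v| = covdeg H [set v].
Proof.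
rewrite -(card_in_imset (@setU1_vlink_inj H v)); congr #|pred_of_set _|.
apply/setP => e; rewrite !inE sub1set; apply/imsetP/andP.
  by case=> f; rewrite inE => /andP[_ fH] ->; rewrite fH setU11.
by case=> eH ve; exists (e :\ v); rewrite ?inE ?eqxx ?setD1K //= eH.
Qed.

Lemma uniform_vlink k H v : uniform k.+1 H -> uniform k (vlink H v).
Proof.
move=> unif; apply/subsetP => f; rewrite !inE => /andP[vf /(uniform_card unif)].
by rewrite cardsU1 vf add1n => -[->].
Qed.

(** For [v] outside [u], adding [v] injects the link edges above [u] into the edges of [H] above
    [v |: u]. Uniformity and size both grow by one, so the cap is the same. *)
Lemma capped_vlink d k H v : capped d k.+1 H -> capped d k (vlink H v).
Proof.
move=> /cappedP capH; apply/cappedP => u u0.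
have [vu|vu] := boolP (v \in u).
  rewrite /covdeg (_ : [set _ in _ | _] = set0) ?cards0 //.
  apply/setP => f; rewrite !inE; apply/negP => /andP[/andP[vf _] /subsetP uf].
  by rewrite (uf _ vu) in vf.
have vu0 : v |: u != set0 by apply/set0Pn; exists v; rewrite setU11.
have := capH _ vu0; rewrite cardsU1 vu add1n subSS; apply: leq_trans.
have inj : {in [set f in vlink H v | u \subset f] &, injective (fun f => v |: f)}.
  move=> f g; rewrite inE => /andP[fL _]; rewrite inE => /andP[gL _].
  exact: (setU1_vlink_inj fL gL).
rewrite /covdeg -(card_in_imset inj); apply: subset_leq_card.
apply/subsetP => _ /imsetP[f + ->]; rewrite !inE => /andP[/andP[_ ->] uf] /=.
exact: setUS.
Qed.

Lemma card_le_sum_covdeg1 k H :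
  uniform k.+1 H -> #|H| <= \sum_v covdeg H [set v].
Proof.
move=> unif.
have -> : \sum_v covdeg H [set v] = \sum_(e in H) \sum_v ([set v] \subset e).
  by under eq_bigr do rewrite covdeg_sum; rewrite exchange_big.
rewrite -sum1_card; apply: leq_sum => e eH.
have /card_gt0P[v ve] : 0 < #|e| by rewrite (uniform_card unif eH).
by rewrite (bigD1 v) //= sub1set ve.
Qed.

(* A maximal admissible B works: every f in A contains a set u on which B
   already uses up at least half of the cap, hence half of the degree in A. *)
Lemma capped_extension d k G A :
  d 0 = 1 -> 0 < k -> uniform k G -> uniform k A ->
  capped d k G -> capped d k A ->
  (forall f u, f \in A -> u != set0 -> u \subset f ->
     2 * covdeg G u <= d (k - #|u|)) ->
  exists2 B : {set {set X}}, B \subset A &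
    [/\ capped d k (G :|: B), [disjoint G & B] & #|A| <= 2 ^ k.+1 * #|B|].
Proof.
move=> d0 k0 unifG unifA capG /cappedP capA room.
pose ok (B : {set {set X}}) := (B \subset A) && capped d k (G :|: B).
have ok0 : ok set0 by rewrite /ok sub0set setU0.
case: (@arg_maxnP _ set0 ok (fun B => #|B|) ok0) => B /andP[sBA capB] maxB.
have nonempty f : f \in A -> f != set0.
  by move=> fA; rewrite -card_gt0 (uniform_card unifA fA).
exists B => //; split => //.
  rewrite -setI_eq0; apply/eqP/setP => f; rewrite !inE; apply/negP => /andP[fG fB].
  have fA := subsetP sBA _ fB.
  (* With [u := f] the cap is [d 0 = 1], and half of it leaves no room for [f] in [G]. *)
  have := room f f fA (nonempty _ fA) (subxx _).
  rewrite (uniform_card unifA fA) subnn d0.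
  by have := covdeg_gt0 fG (subxx f); lia.
pose P u := (u != set0) && (covdeg A u <= 2 * covdeg B u).
have cov f : f \in A -> exists2 u, P u & u \subset f.
  move=> fA; have [fB|fB] := boolP (f \in B).
    exists f => //; rewrite /P nonempty //=.
    have := capA f (nonempty _ fA); rewrite (uniform_card unifA fA) subnn d0.
    by have := covdeg_gt0 fB (subxx f); lia.
  have : ~~ ok (f |: B).
    apply/negP => /maxB; rewrite cardsU1 fB; lia.
  rewrite /ok subUset sub1set fA sBA /=.
  case/forallPn => u; rewrite negb_imply -ltnNge => /andP[u0 ltu].
  move: ltu; rewrite setUCA => ltu.
  have := covdegU [set f] (G :|: B) u; have := covdegU G B u.
  (* Adding [f] changes only the degrees of subsets of [f], so the newly violated [u] lies in
     [f]. *)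
  have [uf|uf] := boolP (u \subset f); last first.
    rewrite (covdeg_set1_notsub uf).
    have := elimT (cappedP _ _ _) capB u u0.
    by move: ltu => /=; lia.
  exists u => //; rewrite /P u0 /=.
  have := capA u u0; have := room f u fA u0 uf; have := covdeg_set1_le1 f u.
  by move: ltu => /=; lia.
apply: leq_trans (card_le_sum_covdeg cov) _.
apply: (@leq_trans (\sum_(u | P u) 2 * covdeg B u)).
  by apply: leq_sum => u /andP[].
rewrite -big_distrr /= expnS -mulnA leq_mul2l /=.
exact/sum_covdeg/(uniform_sub sBA).
Qed.

(** * Optimal capped families inside unions of links *)

Definition links H F : {set {set X}} := \bigcup_(v in F) vlink H v.

Definition admissible d k H F G : bool := (G \subset links H F) && capped d k G.

Definition best d k H F : {set {set X}} :=
  [arg max_(G > set0 | admissible d k H F G) #|G|].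

Lemma bestP d k H F : admissible d k H F (best d k H F) /\
  forall G, admissible d k H F G -> #|G| <= #|best d k H F|.
Proof.
have adm0 : admissible d k H F set0.
  rewrite /admissible sub0set; apply/cappedP => u _.
  by rewrite covdeg_sum big_set0.
by rewrite /best; case: (arg_maxnP _ adm0).
Qed.

Lemma uniform_links k H F : uniform k.+1 H -> uniform k (links H F).
Proof. by move=> unif; apply/bigcupsP => v _; apply: uniform_vlink. Qed.

Lemma links_independent H F I :
  F \subset I -> independent H I -> independent (links H F) I.
Proof.
move=> /subsetP sFI indI f /bigcupP[v vF]; rewrite inE => /andP[_ vfH] fI.
by apply: (indI _ vfH); rewrite subUset sub1set sFI.
Qed.

Lemma independent_sub A B I : A \subset B -> independent B I -> independent A I.
Proof. by move=> /subsetP sAB indB e /sAB; apply: indB. Qed.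

End Hypergraphs.

(** * Numerical estimates *)

Section Estimates.
Local Open Scope ring_scope.
Variables (R : realFieldType) (x y w q h : R).

(* Read x = |X|^delta, y = |X|^eps, w = |X|^(1 + k delta), q = 2^k, h = |H|. *)
Definition estimate_hyps : Prop :=
  [/\ 0 < x, 0 < y, 0 < w, 1 <= q & 16 * q <= y /\ w * x <= h * y].

Lemma estimate_hyps_consequences : estimate_hyps -> 32 * q <= y ^+ 2 /\ 0 <= h.
Proof.
case=> x0 y0 w0 q1 [yq hw]; split.
  have y16 : 16 <= y by lra.
  by have := ler_wpM2r (ltW y0) y16; rewrite expr2; lra.
by rewrite -(pmulr_lge0 _ y0) (le_trans _ hw) // mulr_ge0 ?ltW.
Qed.

(** With [S] saturated edges and an optimal family of size [g]: a small family saturates at most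
    half of the edges. *)
Lemma few_saturated_estimate (S g : R) :
  estimate_hyps -> S <= 4 * x * (2 * q) * g -> g < w / y ^+ 3 -> 2 * S <= h.
Proof.
move=> hyps; have [y2q h0] := estimate_hyps_consequences hyps.
case: hyps => x0 y0 w0 q1 [yq hw] leS.
rewrite ltr_pdivlMr ?exprn_gt0 // => small.
have c0 : 0 <= 4 * x * (2 * q) by nra.
have h1 := ler_wpM2r (exprn_ge0 3 (ltW y0)) leS.
have h2 := ler_wpM2l c0 (ltW small).
have h3 : w * x * (32 * q) <= h * y * y ^+ 2 by apply: ler_pM => //; nra.
have h4 : 0 <= x * w * q by rewrite !mulr_ge0 ?ltW //; lra.
rewrite -(ler_pM2r (exprn_gt0 3 y0)).
have -> : h * y ^+ 3 = h * y * y ^+ 2 by ring.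
apply: le_trans h3.
have -> : 2 * S * y ^+ 3 = 2 * (S * y ^+ 3) by ring.
by move: h1 h2; rewrite -!mulrA; lra.
Qed.

(** Here [n = |X|], [V] counts the gainers, [z = |X|^((k+1) delta)], and [c] is the integer part of
    [z], which bounds vertex degrees in [H]. *)
Lemma many_gainers_estimate (n z V c : R) :
  estimate_hyps -> 0 < z -> 0 <= V -> n * z = w * x -> h <= 4 * V * c -> c <= z ->
  n / y ^+ 3 <= V.
Proof.
move=> hyps; have [y2q h0] := estimate_hyps_consequences hyps.
case: hyps => x0 y0 w0 q1 [yq hw] z0 V0 nz leh cz.
rewrite ler_pdivrMr ?exprn_gt0 //.
have hz : h <= 4 * V * z by apply: le_trans leh _; rewrite ler_wpM2l // mulr_ge0.
have : n * z <= 4 * V * y * z.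
  rewrite nz (le_trans hw) //.
  by have := ler_wpM2r (ltW y0) hz; rewrite -!mulrA [z * y]mulrC.
rewrite ler_pM2r // => /le_trans; apply.
have -> : 4 * V * y = V * (4 * y) by ring.
by rewrite ler_wpM2l // exprSr ler_wpM2r ?ltW //; nra.
Qed.

(** Here [n = |X|], [a = |X|^pi] and [m] is the integer part of [a]. The factor before [m] is the
    gain [t] per vertex. *)
Lemma full_print_estimate (n a m : R) :
  estimate_hyps -> 0 < n -> 0 <= a -> a * x = n -> a <= 2 * m ->
  w / y ^+ 3 <= h / (2 * (2 * (2 * (2 * q))) * n) * m.
Proof.
move=> hyps; have [y2q h0] := estimate_hyps_consequences hyps.
case: hyps => x0 y0 w0 q1 [yq hw] n0 a0 an am; have q0 : 0 < q by lra.
rewrite [leRHS]mulrAC ler_pdivrMr ?exprn_gt0 //.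
rewrite [leRHS]mulrAC ler_pdivlMr; last by nra.
have h1 : w * x * a * (32 * q) <= h * y * (2 * m) * y ^+ 2.
  by apply: ler_pM => //; [nra|nra|apply: ler_pM => //; nra].
have -> : w * (2 * (2 * (2 * (2 * q))) * n) = w * x * a * (32 * q) / 2.
  by rewrite -an; field.
have -> : h * m * y ^+ 3 = h * y * (2 * m) * y ^+ 2 / 2 by field.
by rewrite ler_pM2r.
Qed.

End Estimates.

(** * Counting saturated edges and gainers *)

Section Quantitative.
Local Open Scope ring_scope.
Variables (R : realType) (X : finType).
Implicit Types (H G : {set {set X}}) (F I : {set X}) (v : X).

Definition saturated (d : nat -> nat) (k : nat) H G : {set {set X}} :=
  [set e in H | [exists u : {set X},
     [&& u != set0, u \subset e & (d (k - #|u|) < 2 * covdeg G u)%N]]].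

(** A saturated edge contains some [u] with [d (k - |u|) < 2 * covdeg G u]. The degree of [u] in [H]
    is at most [d (k + 1 - |u|) <= 2 * x * d (k - |u|)], hence at most [4 * x * covdeg G u]; sum
    over [u]. *)
Lemma card_saturated (d : nat -> nat) (x : R) k H G :
  0 <= x -> (forall i, (d i.+1)%:R <= 2 * x * (d i)%:R) ->
  capped d k.+1 H -> uniform k G ->
  #|saturated d k H G|%:R <= 4 * x * 2 ^+ k * #|G|%:R.
Proof.
move=> x0 dS /cappedP capH unifG; set L := saturated _ _ _ _.
pose P (u : {set X}) := (u != set0) && (d (k - #|u|) < 2 * covdeg G u)%N.
have cov e : e \in L -> exists2 u, P u & u \subset e.
  rewrite inE => /andP[_ /existsP[u /and3P[u0 ue su]]].
  by exists u; rewrite // /P u0.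
have sLH : L \subset H by apply/subsetP => e; rewrite inE => /andP[].
apply: (@le_trans _ _ (\sum_(u | P u) covdeg L u)%:R).
  by rewrite ler_nat card_le_sum_covdeg.
apply: (@le_trans _ _ (4 * x * (\sum_(u | P u) covdeg G u)%:R)); last first.
  rewrite -[leRHS]mulrA ler_wpM2l ?mulr_ge0 // -natrX -natrM ler_nat.
  exact: sum_covdeg.
rewrite !natr_sum mulr_sumr; apply: ler_sum => u /andP[u0 su].
have cu : (0 < covdeg G u)%N by lia.
have uk := covdeg_gt0_card unifG cu.
have := capH u u0; rewrite subSn // => capu.
have := dS (k - #|u|)%N.
have : (covdeg L u)%:R <= (d (k - #|u|).+1)%N%:R :> R.
  by rewrite ler_nat (leq_trans (covdegS _ sLH)).
have : (d (k - #|u|))%N%:R <= 2 * (covdeg G u)%:R :> R.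
  by rewrite -natrM ler_nat ltnW.
nra.
Qed.

Definition gainers (d : nat -> nat) (k : nat) H (t : R) F : {set X} :=
  [set v | #|best d k H F|%:R + t <= #|best d k H (v |: F)|%:R].

(** At least half of the edges are unsaturated. Vertices on fewer than [|H| / (4 |X|)] of these
    account for at most [|H| / 4]; the others are gainers, of degree at most [d k]. *)
Lemma card_gainers (d : nat -> nat) k H F :
  let t := #|H|%:R / (2 ^+ k.+3 * #|X|%:R) in
  d 0%N = 1%N -> (0 < k)%N -> (0 < #|X|)%N ->
  uniform k.+1 H -> capped d k.+1 H ->
  2 * #|saturated d k H (best d k H F)|%:R <= #|H|%:R :> R ->
  #|H|%:R <= 4 * #|gainers d k H t F|%:R * (d k)%:R :> R.
Proof.
move=> t d0 k0 X0 unifH capH few; set G := best d k H F in few *.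
set L := saturated _ _ _ _ in few; set V := gainers _ _ _ _ _.
have [/andP[sG capG] _] := bestP d k H F; rewrite -/G in sG capG.
have unifG := uniform_sub sG (uniform_links F unifH).
have sLH : L \subset H by apply/subsetP => e; rewrite inE => /andP[].
pose H' := H :\: L; have sH'H : H' \subset H by apply: subsetDl.
pose s : R := #|H|%:R / (4 * #|X|%:R).
have N0 : 0 < #|X|%:R :> R by rewrite ltr0n.
(* [t] is the degree threshold [s] divided by the loss in [capped_extension]. *)
have ts : t * 2 ^+ k.+1 = s.
  have q0 : 0 < 2 ^+ k :> R by rewrite exprn_gt0.
  rewrite /t /s !exprS; move: (2 ^+ k) q0 (#|X|%:R) N0 (#|H|%:R) => q q0 n n0 h.
  by field; rewrite !gt_eqF.
have gain v : s <= #|vlink H' v|%:R -> v \in V.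
  move=> sv; rewrite inE -/G.
  have sA := vlinkS v sH'H.
  have unifA := uniform_sub sA (uniform_vlink v unifH).
  have capA : capped d k (vlink H' v).
    apply/cappedP => u u0; apply: leq_trans (covdegS _ sA) _.
    exact: (elimT (cappedP _ _ _) (capped_vlink v capH)).
  (* The edge [v |: f] is unsaturated, so no nonempty subset of [f] exceeds half its cap in [G]. *)
  have room (f u : {set X}) : f \in vlink H' v -> u != set0 ->
      u \subset f -> (2 * covdeg G u <= d (k - #|u|))%N.
    rewrite !inE negb_and => /andP[_ /andP[+ vfH]] u0 uf; rewrite vfH /=.
    case/existsPn/(_ u)/nandP; first by rewrite u0.
    rewrite negb_and -leqNgt; case/orP => //.
    by rewrite (subset_trans uf (subsetUr _ _)).
  have [B sB [capB dis leB]] := capped_extension d0 k0 unifG unifA capG capA room.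
  have [_ maxB] := bestP d k H (v |: F).
  have : admissible d k H (v |: F) (G :|: B).
    rewrite /admissible capB andbT subUset; apply/andP; split.
      apply: subset_trans sG _; apply/bigcupsP => w wF.
      by rewrite (bigcup_max w) // !inE wF orbT.
    by rewrite (bigcup_max v) ?setU11 // (subset_trans sB).
  move=> /maxB; rewrite cardsU disjoint_setI0 // cards0 subn0 -(ler_nat R) natrD.
  apply: le_trans; rewrite lerD2l -(ler_pM2r (_ : 0 < 2 ^+ k.+1)) ?exprn_gt0 //.
  rewrite ts (le_trans sv) // -natrX -natrM ler_nat mulnC //.
have unifH' := uniform_sub sH'H unifH.
have : #|H'|%:R <= \sum_v #|vlink H' v|%:R :> R.
  rewrite -natr_sum ler_nat; under eq_bigr do rewrite card_vlink.
  exact: card_le_sum_covdeg1 unifH'.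
rewrite (bigID (mem V)) /=.
have : \sum_(v in V) #|vlink H' v|%:R <= #|V|%:R * (d k)%:R :> R.
  rewrite mulr_natl -sumr_const; apply: ler_sum => v _.
  rewrite ler_nat card_vlink (leq_trans (covdegS _ sH'H)) //.
  have := elimT (cappedP _ _ _) capH [set v].
  by rewrite cards1 subn1; apply; apply/set0Pn; exists v; rewrite set11.
have : \sum_(v | v \notin V) #|vlink H' v|%:R <= #|X|%:R * s.
  apply: (@le_trans _ _ (\sum_(v | v \notin V) s)).
    by apply: ler_sum => v /(contra (@gain v)); rewrite -ltNge => /ltW.
  rewrite sumr_const -[s *+ _]mulr_natl ler_wpM2r ?ler_nat ?max_card //.
  by rewrite /s divr_ge0 // mulr_ge0.
have -> : #|X|%:R * s = #|H|%:R / 4.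
  rewrite /s; move: (#|X|%:R) N0 (#|H|%:R) => n n0 h.
  by field; rewrite gt_eqF.
have : #|H|%:R = #|H'|%:R + #|L|%:R :> R.
  by rewrite -natrD /H' cardsD (setIidPr sLH) subnK // subset_leq_card.
by move: few; lra.
Qed.

End Quantitative.

(** * Prints and containers by induction on the uniformity *)

Section Containers.
Local Open Scope ring_scope.
Variables (R : realType) (X : finType) (delta : R).
Hypotheses (X1 : (1 < #|X|)%N) (delta01 : 0 <= delta <= 1).

Let N : R := #|X|%:R.

Definition cap (i : nat) : nat := Num.truncn (N `^ (i%:R * delta)).

Let N_gt1 : 1 < N. Proof. by rewrite /N ltr1n. Qed.

Let N_gt0 : 0 < N. Proof. exact: lt_trans N_gt1. Qed.

Let powN1 : N `^ 1 = N. Proof. by rewrite powRr1 // ltW. Qed.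

Let N_neq0 : N != 0. Proof. by rewrite gt_eqF. Qed.

Let powN_gt0 a : 0 < N `^ a.
Proof. by rewrite powR_gt0. Qed.

Let powND a b : N `^ (a + b) = N `^ a * N `^ b.
Proof. by rewrite powRD // N_neq0 implybT. Qed.

Let powNB a b : N `^ (a - b) = N `^ a / N `^ b.
Proof. by rewrite powRB // N_neq0 implybT. Qed.

Let powN_ge1 a : 0 <= a -> 1 <= N `^ a.
Proof. by move=> a0; rewrite -(powRr0 N) ler_powR // ltW. Qed.

Lemma cap0 : cap 0 = 1%N.
Proof. by rewrite /cap mul0r powRr0 truncn1. Qed.

(** The factor 2 pays for truncation: a real number at least 1 is at most twice its integer part. *)
Lemma capS i : (cap i.+1)%:R <= 2 * N `^ delta * (cap i)%:R :> R.
Proof.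
have d0 : 0 <= delta by case/andP: delta01.
apply: (@le_trans _ _ (N `^ (i.+1%:R * delta))); first by rewrite truncn_le ltW.
have -> : i.+1%:R * delta = delta + i%:R * delta by rewrite -natr1 mulrDl mul1r addrC.
rewrite powND [2 * _]mulrC -mulrA ler_wpM2l ?ltW //.
have : (0 < cap i)%N by rewrite truncn_gt0 powN_ge1 // mulr_ge0.
have /andP[_] := truncn_itv (ltW (powN_gt0 (i%:R * delta))).
by rewrite -/(cap i) -natr1 -(ler1n R); lra.
Qed.

(** The uniformity is [k.+1], so [k] fingerprints are allowed. Each recursion triples [eps], whence
    [3 ^+ k]. *)
Lemma container_functions k (eps : R) (H : {set {set X}}) :
  0 <= eps -> 2 ^+ (2 * k.+1) <= N `^ eps ->
  uniform k.+1 H -> capped cap k.+1 H ->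
  N `^ (1 + k%:R * delta - eps) <= #|H|%:R ->
  exists (f : {set X} -> seq {set X}) (c : seq {set X} -> {set X}),
  forall I, independent H I ->
  [/\ (size (f I) <= k)%N,
      forall A, A \in f I -> (#|A| <= Num.truncn (N `^ (1 - delta)))%N,
      print_union (f I) \subset I,
      I \subset print_union (f I) :|: c (f I) &
      N `^ (1 - 3 ^+ k * eps) <= #|~: c (f I)|%:R].
Proof.
elim: k eps H => [|k IH] eps H eps0 ybig unifH capH Hbig.
  (* Uniformity 1: the print is empty, and the complement of the container consists of the vertices
     that form edges. *)
  exists (fun=> [::]), (fun=> [set v | [set v] \notin H]) => I indI.
  rewrite /print_union big_nil set0U; split => //; first by rewrite sub0set.
    apply/subsetP => v vI; rewrite inE; apply/negP => /indI; apply.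
    by rewrite sub1set.
  move: Hbig; rewrite mul0r addr0 expr0 mul1r => /le_trans; apply.
  rewrite ler_nat -(card_imset _ (@set1_inj X)); apply: subset_leq_card.
  apply/subsetP => e eH; have /eqP/cards1P[v ev] := uniform_card unifH eH.
  by apply/imsetP; exists v; rewrite ?inE ?negbK -?ev.
set x := N `^ delta; set y := N `^ eps in ybig *; set w := N `^ (1 + k%:R * delta).
have [x0 y0 w0] : [/\ 0 < x, 0 < y & 0 < w] by rewrite !powN_gt0.
have Hw : w * x <= #|H|%:R * y.
  have e : 1 + k.+1%:R * delta - eps = 1 + k%:R * delta + delta - eps.
    by rewrite -natr1; ring.
  by move: Hbig; rewrite e powNB powND ler_pdivrMr.
have y3 : N `^ (3 * eps) = y ^+ 3.
  have -> : 3 * eps = eps + (eps + eps) by ring.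
  by rewrite 2!powND -/y exprS expr2.
have ME : N `^ (1 + k%:R * delta - 3 * eps) = w / y ^+ 3 by rewrite powNB y3.
(* From size [M] on, [g F] meets the homogeneity bound with [3 * eps]. *)
set M := N `^ _ in ME.
set m := Num.truncn _.
pose q : R := 2 ^+ k.
have q1 : 1 <= q by rewrite exprn_ege1 // ler1n.
have yq : 16 * q <= y.
  apply: le_trans ybig.
  rewrite (_ : (2 * k.+2 = k + (k + 4))%N); last by clear; lia.
  rewrite !exprD -/q -natrX mulrA [leRHS]mulrC ler_wpM2l // ler_peMl //.
  by rewrite (le_trans _ q1) // ler01.
have hyps : estimate_hyps x y w q #|H|%:R by split.
pose g F := best cap k.+1 H F.
pose t : R := #|H|%:R / (2 ^+ k.+4 * N).
pose V F := gainers cap k.+1 H t F.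
have unifg F : uniform k.+1 (g F).
  have [/andP[sg _] _] := bestP cap k.+1 H F.
  exact: uniform_sub sg (uniform_links F unifH).
have Vbig F : #|g F|%:R < M -> N `^ (1 - 3 ^+ k.+1 * eps) <= #|V F|%:R.
  move=> small; have small' := small; rewrite ME in small'.
  have few : 2 * #|saturated cap k.+1 H (g F)|%:R <= #|H|%:R :> R.
    apply: (few_saturated_estimate hyps _ small').
    have := card_saturated (ltW x0) capS capH (unifg F).
    by rewrite [2 ^+ k.+1]exprS.
  have leH := card_gainers cap0 (ltn0Sn k) (ltnW X1) unifH capH few.
  have capz : (cap k.+1)%:R <= N `^ (k.+1%:R * delta) by rewrite truncn_le ltW.
  have Nz : N * N `^ (k.+1%:R * delta) = w * x.
    have e : k.+1%:R * delta = k%:R * delta + delta by rewrite -natr1; ring.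
    by rewrite e /w /x !powND powN1 mulrA.
  apply: (@le_trans _ _ (N `^ (1 - 3 * eps))).
    apply: ler_powR; first exact: ltW.
    have : 1 <= 3 ^+ k :> R by rewrite exprn_ege1 // ler1n.
    rewrite exprS => c1; have := ler_wpM2r eps0 c1; rewrite -mulrA; lra.
  rewrite powNB y3 powN1.
  exact: (many_gainers_estimate hyps (powN_gt0 _) _ Nz leH capz).
(* A fingerprint of full size [m] averaging [t] per vertex thus has a family of size at least
   [M]. *)
have tm : M <= t * m%:R.
  have m2 : N `^ (1 - delta) <= 2 * m%:R.
    have : (0 < m)%N.
      by rewrite truncn_gt0 powN_ge1 // subr_ge0; case/andP: delta01.
    have /andP[_] := truncn_itv (ltW (powN_gt0 (1 - delta))).
    by rewrite -/m -natr1 -(ler1n R); lra.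
  have NE : N `^ (1 - delta) * x = N by rewrite -powND subrK powN1.
  rewrite ME /t (_ : 2 ^+ k.+4 = 2 * (2 * (2 * (2 * q)))); last by rewrite !exprS.
  exact: (full_print_estimate hyps N_gt0 (ltW (powN_gt0 _)) NE m2).
(* Stated for every [F], so that [choice] gives functions of [F] alone; for small [g F] the pair is
   a dummy. *)
have rec F : exists fc : ({set X} -> seq {set X}) * (seq {set X} -> {set X}),
    M <= #|g F|%:R -> forall I, independent (g F) I ->
    [/\ (size (fc.1 I) <= k)%N,
      forall A, A \in fc.1 I -> (#|A| <= m)%N,
      print_union (fc.1 I) \subset I,
      I \subset print_union (fc.1 I) :|: fc.2 (fc.1 I) &
      N `^ (1 - 3 ^+ k.+1 * eps) <= #|~: fc.2 (fc.1 I)|%:R].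
  have [leM|ltM] := boolP (M <= #|g F|%:R); last by exists (fun=> [::], fun=> set0).
  have capg : capped cap k.+1 (g F) by have [/andP[]] := bestP cap k.+1 H F.
  have yle : y <= N `^ (3 * eps).
    by rewrite /y ler_powR //; [exact: ltW|lra].
  have [||f [c fcP]] := IH (3 * eps) (g F) _ _ (unifg F) capg leM.
  - by lra.
  - apply: le_trans yle; apply: le_trans ybig.
    by rewrite ler_eXn2l ?ltr1n // leq_mul2l leqnSn.
  by exists (f, c) => _ I /fcP; rewrite mulrA -exprSr.
have [fc fcP] := choice rec.
pose good (I F : {set X}) :=
  [&& F \subset I, (#|F| <= m)%N & t * #|F|%:R <= #|g F|%:R].
pose pick I : {set X} := [arg max_(F > set0 | good I F) #|F|]%N.
pose big F := M <= #|g F|%:R.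
exists (fun I => pick I :: if big (pick I) then (fc (pick I)).1 I else [::]).
(* The head of the print recovers [F], hence the case; the tail is a print for [g F]. The default
   [set0] is never met, as the prints built above are nonempty. *)
exists (fun s => if big (head set0 s) then (fc (head set0 s)).2 (behead s)
                 else ~: V (head set0 s)).
move=> I indI /=.
have good0 : good I set0 by rewrite /good sub0set cards0 mulr0 /=.
have : extremum_spec geq (good I) (fun F => #|F|) (pick I) by apply: arg_maxnP.
case=> F /and3P[sFI leFm tF] maxF.
have indg : independent (g F) I.
  have [/andP[sg _] _] := bestP cap k.+1 H F.
  exact: independent_sub sg (links_independent sFI indI).
case: ifP => [bigF|/negbT]; rewrite /print_union big_cons.
  have [szf fA uI Iu cbig] := fcP F bigF I indg; split => //.
  - by move=> A; rewrite inE => /predU1P[->|/fA].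
  - by rewrite subUset sFI.
  - by rewrite -setUA subsetU // Iu orbT.
rewrite -ltNge => smallF; rewrite big_nil setU0; split => //.
- by move=> A; rewrite inE => /eqP ->.
- apply/subsetP => v vI; rewrite !inE -implyNb; apply/implyP => vF.
  apply/negP => gain.
  (* At full size, [tm] would contradict [smallF]. *)
  have ltFm : (#|F| < m)%N.
    rewrite ltn_neqAle leFm andbT; apply/eqP => Fm.
    by move: smallF tF; rewrite Fm; move: tm; lra.
  (* The gain of [v] preserves the average [t], against the maximality of [F]. *)
  have /maxF : good I (v |: F).
    rewrite /good subUset sub1set vI sFI cardsU1 vF add1n ltFm /= -natr1.
    by apply: le_trans gain; rewrite mulrDr mulr1 lerD2r.
  by rewrite /geq /= cardsU1 vF add1n ltnn.
by rewrite setCK Vbig.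
Qed.

End Containers.

(** * From bounded degrees to caps *)

Lemma covdeg_le_deg (X : finType) k (H : {set {set X}}) u :
  uniform k H -> (covdeg H u <= deg k H u)%N.
Proof.
move=> unif.
have inj : {in [set e in H | u \subset e] &, injective (fun e => e :\: u)}.
  move=> e f; rewrite inE => /andP[_ ue]; rewrite inE => /andP[_ uf] eqD.
  by rewrite -(setID e u) -(setID f u) eqD (setIidPr ue) (setIidPr uf).
rewrite /covdeg -(card_in_imset inj); apply: subset_leq_card.
apply/subsetP => _ /imsetP[e + ->]; rewrite !inE => /andP[eH ue].
rewrite cardsD (setIidPr ue) (uniform_card unif eH) eqxx /=.
by rewrite setDE setUIr setUCr setIT (setUidPr ue).
Qed.

(** Sets smaller than an edge are covered by [bounded]. For larger [u] the cap is [cap 0 = 1], and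
    an edge containing [u] equals [u]. *)
Lemma capped_bounded (R : realType) (X : finType) (delta : R) k
    (H : {set {set X}}) :
  uniform k H -> bounded k delta H -> capped (cap X delta) k H.
Proof.
move=> unif bnd; apply/cappedP => u u0.
have [uk|ku] := ltnP #|u| k.
  rewrite truncn_ge_nat ?powR_ge0 //; apply: le_trans (bnd #|u| _); last first.
    by rewrite uk card_gt0 u0.
  rewrite ler_nat (leq_trans (covdeg_le_deg u unif)) //.
  by apply: (@leq_bigmax_cond _ _ (deg k H)); rewrite inE.
rewrite (eqP ku) cap0 -(cards1 u); apply: subset_leq_card.
apply/subsetP => e; rewrite !inE => /andP[eH ue].
by rewrite eq_sym eqEcard ue (uniform_card unif eH).
Qed.

(** * Logarithmic bounds as bounds by powers of [|X|] *)

Section Logarithms.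
Local Open Scope ring_scope.
Variables (R : realType) (X : finType).
Hypothesis X1 : (1 < #|X|)%N.

Let lnN_gt0 : 0 < ln (#|X|%:R : R). Proof. by rewrite ln_gt0 // ltr1n. Qed.

Let N_gt0 : 0 < #|X|%:R :> R. Proof. by rewrite ltr0n ltnW. Qed.

(** For [n = 0] both sides fail: the logarithm is [-oo], and powers of [|X|] are positive. *)
Lemma le_logX (a : R) n :
  (a%:E <= logX R X n)%E = (#|X|%:R `^ a <= n%:R).
Proof.
rewrite /logX; case: n => [|n] /=.
  by apply/esym/negbTE; rewrite -ltNge powR_gt0.
rewrite lee_fin ler_pdivlMr // -ln_powR ler_ln //.
  by rewrite posrE powR_gt0.
by rewrite posrE ltr0n.
Qed.

Lemma logX_le (a : R) n :
  n%:R <= #|X|%:R `^ a -> (logX R X n <= a%:E)%E.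
Proof.
rewrite /logX; case: n => [|n] /= len; first exact: leNye.
rewrite lee_fin ler_pdivrMr // -ln_powR ler_ln //.
  by rewrite posrE ltr0n.
by rewrite posrE powR_gt0.
Qed.

Lemma expr2_le_powR (j : nat) (a : R) :
  (j%:R%:E * logX R X 2 <= a%:E)%E -> 2 ^+ j <= #|X|%:R `^ a.
Proof.
rewrite /logX /= -EFinM lee_fin mulrA ler_pdivrMr // => le_ln.
rewrite -ler_ln ?posrE ?powR_gt0 ?exprn_gt0 //.
by rewrite ln_powR lnXn // -[_ *+ j]mulr_natl.
Qed.

End Logarithms.

(** * The two relations as graphs of the print and container functions *)

Theorem theorem3p5 (R : realType) (k : nat) (pi eps : R) (X : finType)
    (H : {set {set X}}) :
  (0 < k)%N ->
  (0 <= pi <= 1)%R ->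
  (0 < eps)%R ->
  (1 < #|X|)%N ->
  (((2 * k)%N%:R)%R%:E * logX R X 2 <= eps%:E)%E ->
  (((k.-1)%:R)%R%:E * logX R X 2 <= pi%:E)%E ->
  uniform k H ->
  homogeneous k (1 - pi)%R eps H ->
  exists (P : set ({set X} * seq {set X})) (C : set (seq {set X} * {set X})),
    print_container_pair k pi (3 ^+ k.-1 * eps)%R H P C.
Proof.
case: k => // k _ pi01 eps0 X1 epsbig _ unif [bnd Hbig].
have delta01 : (0 <= 1 - pi <= 1)%R by lra.
have cappedH := capped_bounded unif bnd.
rewrite le_logX // in Hbig.
have [f [c fcP]] := container_functions X1 delta01 (ltW eps0)
  (expr2_le_powR X1 epsbig) unif cappedH Hbig.
have printf I : independent H I -> prints pi k.+1 (f I).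
  move=> /fcP[szf fA _ _ _]; split => // A /fA leA; apply: logX_le => //.
  rewrite -truncn_ge_nat ?powR_ge0 //.
  by move: leA; rewrite (_ : 1 - (1 - pi) = pi)%R //; ring.
exists (fun IF => independent H IF.1 /\ IF.2 = f IF.1).
(* Restricted to prints of independent sets, since only their containers are known to have large
   complement. *)
exists (fun FD => (exists2 I, independent H I & FD.1 = f I) /\ FD.2 = c FD.1).
split=> [[I F] /= [indI ->]|[F D] /= [[I indI ->] _]|].
  by split; last exact: printf.
  by split => //; apply: printf.
split=> [I indI|F [I [/= indI FI]]|I F D [/= indI FI] [_ /= DF]|D [F [[I indI /= FI] DF]]].
- by exists (f I).
- by exists (c F); split => //; exists I.
- by subst F D; have [_ _ -> ->] := fcP I indI.
- move: DF FI => /= -> ->; rewrite le_logX //.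
  by have [_ _ _ _] := fcP I indI.
Qed.
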